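(* Let $A,B\in\mathbb{C}^{n\times n}$ be nilpotent matrices. Let $\alpha=(\alpha_1,\ldots,\alpha_r)$ and $\beta=(\beta_1,\ldots,\beta_s)$ be the reduced Segre characteristics of $A$ and $B$, respectively. Then the lattices $\mathrm{Hinv}(A)$ and $\mathrm{Hinv}(B)$ are isomorphic if and only if one of the following conditions is satisfied: 1. $\alpha=(5,2)$ and $\beta=(4,2,1)$, or $\alpha=(4,2,1)$ and $\beta=(5,2)$; 2. for some integer $l\ge 2$, $\alpha=(l,l-1)$ and $\beta=(2l-1)$, or $\alpha=(2l-1)$ and $\beta=(l,l-1)$; 3. $\alpha=\beta$.
   Context: For $A\in\mathbb{C}^{n\times n}$, let $Z(A)=\{B\in\mathbb{C}^{n\times n}: AB=BA\}$. A subspace $F\subseteq\mathbb{C}^{n\times 1}$ is hyperinvariant for $A$ if $BF\subseteq F$ for all $B\in Z(A)$. $\mathrm{Hinv}(A)$ is the lattice of hyperinvariant subspaces of $A$ (ordered by inclusion; meet is intersection, join is sum). Lattice isomorphisms are bijections preserving joins and meets. The Segre characteristic of a nilpotent matrix is the nonincreasing list of the sizes of its Jordan blocks (with multiplicity); the reduced Segre characteristic is the strictly decreasing list $\alpha_1>\cdots>\alpha_r>0$ of the distinct sizes of its Jordan blocks (repetitions removed). *)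

(* Defs.v *)
From HB Require Import structures.
From mathcomp Require Import all_boot all_order all_algebra.
From mathcomp Require Import complex.
From mathcomp Require Import boolp reals.

Set Implicit Arguments.
Unset Strict Implicit.
Unset Printing Implicit Defensive.

Import Order.TTheory GRing.Theory Num.Theory.
Local Open Scope ring_scope.

Definition nilpotent_mx (F : fieldType) (n : nat) (A : 'M[F]_n) : Prop :=
  exists k : nat, A ^+ k = 0.

Definition hyperinvariant (F : fieldType) (n : nat) (A : 'M[F]_n)
    (U : {vspace 'cV[F]_n}) : Prop :=
  forall B : 'M[F]_n, comm_mx A B -> forall v, v \in U -> B *m v \in U.

Record Hinv (F : fieldType) (n : nat) (A : 'M[F]_n) := HinvSub {
  hinv_space :> {vspace 'cV[F]_n};
  _ : `[< hyperinvariant A hinv_space >]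
}.

HB.instance Definition _ (F : fieldType) (n : nat) (A : 'M[F]_n) :=
  [isSub for @hinv_space F n A].
HB.instance Definition _ (F : fieldType) (n : nat) (A : 'M[F]_n) :=
  [Choice of Hinv A by <:].

Lemma hinvP (F : fieldType) (n : nat) (A : 'M[F]_n) (U : Hinv A) :
  hyperinvariant A U.
Proof. exact/asboolP/(valP U). Qed.

Lemma hyperinvariant_cap (F : fieldType) (n : nat) (A : 'M[F]_n)
    (U V : Hinv A) : `[< hyperinvariant A (U :&: V)%VS >].
Proof.
apply/asboolP => B AB v; rewrite !memv_cap => /andP[vU vV].
by apply/andP; split; apply: hinvP.
Qed.

Lemma hyperinvariant_add (F : fieldType) (n : nat) (A : 'M[F]_n)
    (U V : Hinv A) : `[< hyperinvariant A (U + V)%VS >].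
Proof.
apply/asboolP => B AB _ /memv_addP[u uU [v vV ->]]; rewrite mulmxDr.
by apply: memv_add; apply: hinvP.
Qed.

Section HinvLattice.
Variables (F : fieldType) (n : nat) (A : 'M[F]_n).

Fact hinv_display : Order.disp_t. Proof. exact: Order.Disp tt tt. Qed.

Definition hinv_le (U V : Hinv A) : bool := (U <= V)%VS.
Definition hinv_meet (U V : Hinv A) : Hinv A :=
  HinvSub (hyperinvariant_cap U V).
Definition hinv_join (U V : Hinv A) : Hinv A :=
  HinvSub (hyperinvariant_add U V).

Fact hinv_le_refl : reflexive hinv_le.
Proof. by move=> U; exact: subvv. Qed.

Fact hinv_le_anti : antisymmetric hinv_le.
Proof. by move=> U V UV; apply/val_inj/eqP; rewrite eqEsubv. Qed.

Fact hinv_le_trans : transitive hinv_le.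
Proof. by move=> V U W; exact: subv_trans. Qed.

HB.instance Definition _ := Order.Le_isPOrder.Build hinv_display (Hinv A)
  hinv_le_refl hinv_le_anti hinv_le_trans.

Fact hinv_meetP (U V W : Hinv A) :
  (U <= hinv_meet V W)%O = (U <= V)%O && (U <= W)%O.
Proof. exact: subv_cap. Qed.

Fact hinv_joinP (U V W : Hinv A) :
  (hinv_join U V <= W)%O = (U <= W)%O && (V <= W)%O.
Proof. exact: subv_add. Qed.

HB.instance Definition _ := Order.POrder_MeetJoin_isLattice.Build hinv_display
  (Hinv A) hinv_meetP hinv_joinP.

End HinvLattice.

Definition lattice_isomorphic (d d' : Order.disp_t)
    (L : latticeType d) (L' : latticeType d') : Prop :=
  exists f : L -> L',
    [/\ bijective f,
        {morph f : x y / (x `&` y)%O >-> (x `&` y)%O}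
      & {morph f : x y / (x `|` y)%O >-> (x `|` y)%O}].

Definition nilp_jordan_block (F : fieldType) (k : nat) : 'M[F]_k :=
  \matrix_(i, j) (i.+1 == j :> nat)%:R.

Definition nilp_jordan_mx (F : fieldType) (s : seq nat) :
    'M[F]_(\sum_(i < size s) nth 0%N s i) :=
  \mxdiag_(i < size s) nilp_jordan_block F (nth 0%N s i).

(* s is the Segre characteristic of the nilpotent matrix A: 0 being the only
   eigenvalue, the Jordan form of A is built from the blocks above; the
   equation e only transports it to the dimension of A. *)
Definition is_segre (F : fieldType) (n : nat) (A : 'M[F]_n) (s : seq nat) :
    Prop :=
  [/\ sorted geq s, all (ltn 0) s
    & exists e : (\sum_(i < size s) nth 0%N s i)%N = n,
        A ~_{in unitmx} castmx (e, e) (nilp_jordan_mx F s)].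

(* undup removes repetitions from the nonincreasing list s, which leaves the
   strictly decreasing list of the distinct block sizes. *)
Definition is_reduced_segre (F : fieldType) (n : nat) (A : 'M[F]_n)
    (alpha : seq nat) : Prop :=
  exists2 s : seq nat, is_segre A s & alpha = undup s.

(* Main.v *)
Require Import Defs.
From mathcomp Require Import all_boot all_order all_algebra.
From mathcomp Require Import complex.
From mathcomp Require Import reals boolp.
From mathcomp Require Import zify.

(** Give a vector of a Jordan basis of A the coordinates (x, y), where x is
    its height above the kernel end of its Jordan chain and y its depth below
    the generator of the chain; the chain has size x + y + 1.  A matrix that
    commutes with A preserves the kernels and the images of the powers of A, so
    it can only lower x and raise y; conversely the matrices shifting one
    Jordan chain into another commute with A and realize every such move.
    Hence a hyperinvariant subspace is spanned by the basis vectors that it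
    contains, and these form a down-set of the poset [points alpha] of all
    (x, y) with x + y + 1 in alpha, ordered by x <= x' and y' <= y.  So Hinv(A)
    is the lattice of down-sets of [points alpha] ([jordan_principal_family]).
    The points are recovered as the join-prime elements, so two such lattices
    are isomorphic exactly when the posets are ([lattice_iso_of_poset_iso],
    [poset_iso_of_lattice_iso]).

    With x - y as time and x + y as space, [points alpha] is a family of
    parallel world lines ordered by causality: each size a gives a line of a
    points, and two lines at distance one interleave into a chain.  This
    is why (l, l-1) and (2l-1) both give a chain of 2l - 1 points.

    Otherwise let a be the largest size and g the largest size that is at most
    a - 2.  Everything is comparable with the first few points, and the poset
    then splits at exactly two points, the forks (1, a-2) and (0, g-1)
    ([branching_fork]).  The points above the first one are those with x > 0;
    they form the poset of the sizes decreased by one.  The points not above it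
    are those with x = 0, one for each size, and the points not above the
    second one are those with y >= g, of which there are a - g when a - 1 is
    not a size.  An isomorphism maps forks to forks.  If it respects the two
    kinds, then it induces an isomorphism between the posets of the decreased
    sizes, and induction applies ([classify_straight]).  If it exchanges them,
    then the poset of the decreased sizes of alpha is isomorphic to the part
    y < h of [points beta], where h is the analogue of g.  Inspecting the
    forks of that part shows that both lists have at most three entries
    ([swap_loose], [swap_tight]), and counting points leaves only equality or
    the pair (5, 2), (4, 2, 1) ([classify_swap]). *)

Set Implicit Arguments.
Unset Strict Implicit.
Unset Printing Implicit Defensive.

Import Order.TTheory GRing.Theory.

Local Open Scope nat_scope.

(** * The poset of a list of sizes *)

(** Causality of the plane whose time is x - y and whose space is x + y. *)
Definition cone_le (p q : nat * nat) : bool := (p.1 <= q.1) && (q.2 <= p.2).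

Definition cone_cmp (p q : nat * nat) : bool := cone_le p q || cone_le q p.

(** Coordinates (height, depth) of the vectors of a Jordan basis, one Jordan
    block for each size; repeated blocks give the same points. *)
Definition points (s : seq nat) : pred (nat * nat) :=
  fun p => (p.1 + p.2).+1 \in s.

Definition poset_iso (X Y : pred (nat * nat)) (f g : nat * nat -> nat * nat) :=
  [/\ forall p, X p -> Y (f p), forall q, Y q -> X (g q),
      forall p, X p -> g (f p) = p, forall q, Y q -> f (g q) = q
    & forall p q, X p -> X q -> cone_le (f p) (f q) = cone_le p q].

Lemma cone_le_refl p : cone_le p p.
Proof. by rewrite /cone_le !leqnn. Qed.

Lemma cone_le_trans q p r : cone_le p q -> cone_le q r -> cone_le p r.
Proof. rewrite /cone_le; lia. Qed.

Lemma cone_le_anti p q : cone_le p q -> cone_le q p -> p = q.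
Proof.
by case: p q => [x y] [x' y']; rewrite /cone_le /= => ? ?; congr (_, _); lia.
Qed.

Lemma cone_cmpC p q : cone_cmp p q = cone_cmp q p.
Proof. exact: orbC. Qed.

Lemma poset_iso_sym X Y f g : poset_iso X Y f g -> poset_iso Y X g f.
Proof.
move=> [fY gX gf fg fle]; split=> // p q Yp Yq.
by rewrite -fle ?gX // !fg.
Qed.

Lemma poset_iso_comp X Y Z f g f' g' :
  poset_iso X Y f g -> poset_iso Y Z f' g' ->
  poset_iso X Z (f' \o f) (g \o g').
Proof.
move=> [fY gX gf fg fle] [fZ gY gf' fg' fle']; split=> /= *.
- by apply: fZ; apply: fY.
- by apply: gX; apply: gY.
- by rewrite gf' ?gf //; apply: fY.
- by rewrite fg ?fg' //; apply: gY.
- by rewrite fle' ?fle //; apply: fY.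
Qed.

(** Used for up-sets generated by a point: these are the parts of the posets
    in which the induction and the exchange argument take place. *)
Lemma poset_iso_restrict X Y f g (a b : pred (nat * nat)) :
    poset_iso X Y f g -> (forall p, X p -> a p = b (f p)) ->
  poset_iso (fun p => X p && a p) (fun q => Y q && b q) f g.
Proof.
move=> [fY gX gf fg fle] ab; split=> [p|q|p|q|p q].
- by case/andP=> Xp ap; rewrite fY //= -ab.
- by case/andP=> Yq bq; rewrite gX //= ab ?gX // fg.
- by case/andP=> Xp _; apply: gf.
- by case/andP=> Yq _; apply: fg.
- by case/andP=> Xp _ /andP[Xq _]; apply: fle.
Qed.

Lemma poset_iso_leq_size X Y f g s t : poset_iso X Y f g -> uniq s ->
  all X s -> (forall q, Y q -> q \in t) -> size s <= size t.
Proof.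
move=> [fY gX gf fg fle] us /allP sX Yt; rewrite -(size_map f).
apply: uniq_leq_size => [|_ /mapP[p /sX Xp ->]]; last by apply/Yt/fY.
rewrite map_inj_in_uniq // => p q /sX Xp /sX Xq fpq.
by rewrite -(gf p) // fpq gf.
Qed.

Definition chain_poset (X : pred (nat * nat)) :=
  forall p q, X p -> X q -> cone_cmp p q.

(** The places where the poset ceases to be a chain, seen from below.  The
    definition only uses the order, so isomorphisms preserve it. *)
Definition fork (X : pred (nat * nat)) (p : nat * nat) :=
  [/\ X p, exists2 q, X q & ~~ cone_cmp p q
    & forall p', X p' -> cone_le p' p -> p' != p ->
      forall q, X q -> cone_cmp p' q].

Lemma chain_poset_iso X Y f g :
  poset_iso X Y f g -> chain_poset X -> chain_poset Y.
Proof.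
move=> /poset_iso_sym [fX gY gf fg gle] cX p q Yp Yq.
have:= cX _ _ (fX p Yp) (fX q Yq); by rewrite /cone_cmp !gle.
Qed.

Lemma fork_iso X Y f g p : poset_iso X Y f g -> fork X p -> fork Y (f p).
Proof.
move=> fiso; have [fY gX gf fg fle] := fiso.
have cmpf a b : X a -> X b -> cone_cmp (f a) (f b) = cone_cmp a b.
  by move=> Xa Xb; rewrite /cone_cmp !fle.
case=> Xp [q Xq npq] pmin; split; first exact: fY.
  by exists (f q); [apply: fY | rewrite cmpf].
move=> p' Yp' le_p'p ne_p'p r Yr.
rewrite -(fg p') // -(fg r) // cmpf ?gX //; apply: pmin; rewrite ?gX //.
  by rewrite -fle ?gX // fg.
by apply: contraNneq ne_p'p => <-; rewrite fg.
Qed.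

(** The lists that occur as reduced Segre characteristics. *)
Definition reduced (s : seq nat) := sorted gtn s && all (ltn 0) s.

Definition pts (s : seq nat) : seq (nat * nat) :=
  flatten [seq [seq (x, a.-1 - x) | x <- iota 0 a] | a <- s].

Lemma pts_cons a s :
  pts (a :: s) = [seq (x, a.-1 - x) | x <- iota 0 a] ++ pts s.
Proof. by []. Qed.

Lemma mem_pts s p : (p \in pts s) = points s p.
Proof.
rewrite /points; elim: s => [|a s IHs] //=.
rewrite pts_cons mem_cat inE {}IHs; congr (_ || _); case: p => x y /=.
apply/mapP/eqP => [[z]|<-].
  by rewrite mem_iota => /andP[_ za] [-> ->]; lia.
exists x; first by rewrite mem_iota; lia.
by congr (_, _); lia.
Qed.

Lemma uniq_pts s : uniq s -> uniq (pts s).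
Proof.
elim: s => [|a s IHs] //= /andP[sa us].
rewrite pts_cons cat_uniq IHs // andbT.
rewrite map_inj_uniq ?iota_uniq /= => [|x y [->] //].
apply/hasPn => p; rewrite mem_pts /points => sp.
apply: contra sa => /mapP[x]; rewrite mem_iota => /andP[_ xa] p_x.
have <- // : (p.1 + p.2).+1 = a by rewrite p_x /=; lia.
Qed.

Lemma size_pts s : size (pts s) = sumn s.
Proof.
by elim: s => [|a s IHs] //; rewrite pts_cons size_cat size_map size_iota IHs.
Qed.

Lemma count_pts_x0 s : all (ltn 0) s ->
  count (fun p => p.1 == 0) (pts s) = size s.
Proof.
elim: s => [|a s IHs] //= /andP[a0 /IHs{}IHs].
rewrite pts_cons count_cat {}IHs count_map -add1n; congr (_ + _).
case: a a0 => [|a] //= _.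
rewrite (eq_in_count (a2 := pred0)) ?count_pred0 // => x.
by rewrite mem_iota /=; lia.
Qed.

Lemma count_pts_y g s :
  count (fun p => g <= p.2) (pts s) = sumn [seq a - g | a <- s].
Proof.
elim: s => [|a s IHs] //=; rewrite pts_cons count_cat {}IHs count_map.
congr (_ + _); rewrite (eq_in_count (a2 := fun x => x < 0 + (a - g))).
  by rewrite -size_filter (filter_iota_ltn _ (leq_subr g a)) size_iota.
by move=> x; rewrite mem_iota /=; lia.
Qed.

Lemma reduced_cons a s :
  reduced (a :: s) = [&& 0 < a, all (gtn a) s & reduced s].
Proof.
rewrite /reduced /= path_sortedE; last by move=> x y z /=; lia.
by rewrite -!andbA; do !bool_congr.
Qed.

Lemma reduced_uniq s : reduced s -> uniq s.
Proof. by rewrite /reduced gtn_sorted_uniq_geq => /andP[/andP[]]. Qed.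

Lemma reduced_gt0 s x : reduced s -> x \in s -> 0 < x.
Proof. by case/andP=> _ /allP; apply. Qed.

Lemma poset_iso_count s t f g (a b : pred (nat * nat)) :
    reduced s -> reduced t -> poset_iso (points s) (points t) f g ->
    (forall p, points s p -> a p = b (f p)) ->
  count a (pts s) = count b (pts t).
Proof.
move=> /reduced_uniq us /reduced_uniq ut fiso ab.
have fab := poset_iso_restrict fiso ab.
rewrite -!size_filter; apply/eqP; rewrite eqn_leq; apply/andP; split.
  apply: poset_iso_leq_size fab _ _ _; rewrite ?filter_uniq ?uniq_pts //.
    by apply/allP => p; rewrite mem_filter mem_pts andbC.
  by move=> p; rewrite mem_filter mem_pts andbC.
apply: poset_iso_leq_size (poset_iso_sym fab) _ _ _;
  rewrite ?filter_uniq ?uniq_pts //.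
  by apply/allP => p; rewrite mem_filter mem_pts andbC.
by move=> p; rewrite mem_filter mem_pts andbC.
Qed.

Lemma poset_iso_sumn s t f g : reduced s -> reduced t ->
  poset_iso (points s) (points t) f g -> sumn s = sumn t.
Proof.
move=> rs rt fiso; rewrite -!size_pts -!count_predT.
exact: (poset_iso_count rs rt fiso).
Qed.

Definition dec (s : seq nat) := [seq a.-1 | a <- s & 1 < a].

Lemma dec_cons a s : dec (a :: s) = if 1 < a then a.-1 :: dec s else dec s.
Proof. by rewrite /dec /=; case: ifP. Qed.

Lemma mem_dec k s : (k \in dec s) = (0 < k) && (k.+1 \in s).
Proof.
elim: s => [|a s IHs]; first by rewrite andbF.
rewrite dec_cons !inE andb_orr -IHs; case: ltnP => a1.
  by rewrite inE; congr (_ || _); lia.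
by have -> : (0 < k) && (k.+1 == a) = false by lia.
Qed.

Lemma points_dec s p : points (dec s) p = points s (p.1.+1, p.2).
Proof. by rewrite /points mem_dec. Qed.

Lemma reduced_dec s : reduced s -> reduced (dec s).
Proof.
elim: s => [|a s IHs] //; rewrite reduced_cons dec_cons => /and3P[_ sa /IHs rs].
case: ifP => // a1; rewrite reduced_cons rs andbT; apply/andP; split; first lia.
apply/allP => x; rewrite mem_dec => /andP[_ /(allP sa)] /=; lia.
Qed.

(** Decreasing loses only the information whether 1 is a size, which the length
    of the list restores. *)
Lemma dec_split s : reduced s ->
  s = map S (dec s) \/ s = rcons (map S (dec s)) 1.
Proof.
elim: s => [|a s IHs] /=; first by left.
rewrite reduced_cons dec_cons => /and3P[a0 sa rs]; case: ltnP => a1.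
  by case: (IHs rs) => e; [left | right]; rewrite {1}e /=; case: a a1 {a0 sa}.
right; have -> : a = 1 by lia.
case: s sa rs {IHs} => [|x s] //= /andP[xa _].
rewrite reduced_cons => /andP[x0 _]; lia.
Qed.

Lemma size_dec s : size (dec s) <= size s.
Proof. by rewrite size_map size_filter count_size. Qed.

(** The points of positive height form the poset of the decreased sizes: the
    geometric form of the induction step. *)
Lemma dec_iso s :
  poset_iso (points (dec s)) (fun p => points s p && (0 < p.1))
    (fun p => (p.1.+1, p.2)) (fun p => (p.1.-1, p.2)).
Proof.
split=> [p|[x y]|p|[x y]|p q] //=.
- by rewrite points_dec => ->.
- by rewrite points_dec /= => /andP[+ x0]; rewrite prednK.
- by case: p.
- by case/andP=> _ x0; rewrite prednK.
Qed.

(** The first gap of the list: a is the largest size and g the largest one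
    such that the lines of a and g do not interleave into a chain. *)
Definition branching (s : seq nat) (a g : nat) :=
  [/\ a \in s, g \in s, 0 < g, g.+2 <= a
    & forall x, x \in s -> x <= g \/ a <= x.+1 /\ x <= a].

(** A list with gap (a, g) starts with a, g or with a, a - 1, g.  In the second
    case the lines a and a - 1 interleave below the forks, which changes the
    number of points below each fork and the counts. *)
Definition branching_list (s : seq nat) (a g : nat) (s' : seq nat) :=
  (s = [:: a, g & s'] /\ a.-1 \notin s) \/ s = [:: a, a.-1, g & s'].

(** A point of positive height lies above (1, a-2), and a point (0, y) with
    y < g lies above (0, g-1); the remaining points (0, y) come from the sizes a
    and a - 1 and are comparable with everything. *)
Lemma branching_fork s a g p : branching s a g ->
  fork (points s) p <-> p = (0, g.-1) \/ p = (1, a.-2).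
Proof.
move=> [sa sg g0 ga gap].
have sm1 : points s (1, a.-2) by rewrite /points /= (_ : _.+1 = a) //; lia.
have sm2 : points s (0, g.-1) by rewrite /points /= add0n prednK.
have ncmp : ~~ cone_cmp (1, a.-2) (0, g.-1).
  by rewrite /cone_cmp /cone_le /=; lia.
split=> [[sp [q sq npq] pmin]|].
  case: p sp npq pmin => [[|x] y] sp npq pmin.
    have [|y1] : y.+1 <= g \/ a <= y.+2 /\ y.+1 <= a by exact: (gap _ sp).
      rewrite leq_eqVlt => /orP[/eqP <-|yg]; first by left.
      have := pmin _ sm2; rewrite /cone_le /= xpair_eqE.
      have -> : (y <= g.-1) = true by lia.
      have -> : (g.-1 == y) = false by lia.
      by move=> /(_ isT isT _ sm1); rewrite cone_cmpC (negPf ncmp).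
    case/negP: npq; case: q sq => [x' y']; rewrite /points /= => sq.
    have := gap _ sq; rewrite /cone_cmp /cone_le /=; lia.
  right; apply/eqP; case: eqP => // /eqP ne.
  have := pmin _ sm1; rewrite /cone_le /= eq_sym ne.
  have -> : y <= a.-2 by have := gap _ sp; rewrite /=; lia.
  by move=> /(_ isT isT _ sm2); rewrite (negPf ncmp).
case=> -> {p}; split=> //.
- by exists (1, a.-2) => //; rewrite cone_cmpC.
- case=> [x y] sp; rewrite /cone_le /= xpair_eqE => le_p ne_p [x' y'] sq.
  by have := gap _ sp; have := gap _ sq; rewrite /cone_cmp /cone_le /=; lia.
- by exists (0, g.-1).
case=> [x y] sp; rewrite /cone_le /= xpair_eqE => le_p ne_p [x' y'] sq.
by have := gap _ sp; have := gap _ sq; rewrite /cone_cmp /cone_le /=; lia.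
Qed.

Lemma above_right_fork s a g p : branching s a g -> points s p ->
  cone_le (1, a.-2) p = (0 < p.1).
Proof.
move=> [_ _ g0 ga gap] /gap; rewrite /cone_le /=; lia.
Qed.

Lemma above_left_fork g (p : nat * nat) : 0 < g ->
  cone_le (0, g.-1) p = (p.2 < g).
Proof. by rewrite /cone_le /=; lia. Qed.

(** Three sizes span a distance of at least two, so a list without a gap has
    at most two entries. *)
Lemma reduced_shape s : reduced s ->
  [/\ chain_poset (points s) & [\/ s = [::], exists a, s = [:: a]
        | exists a, s = [:: a.+1; a]]] \/
  exists a g s', branching s a g /\ branching_list s a g s'.
Proof.
case: s => [|a s]; first by left; split=> //; constructor 1.
rewrite reduced_cons => /and3P[a0 sa rs].
case: s sa rs => [|g s].
  move=> _ _; left; split; last by constructor 2; exists a.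
  case=> [x y] [x' y']; rewrite /points /= !inE /cone_cmp /cone_le /=; lia.
rewrite reduced_cons /= => /andP[ga sa] /and3P[g0 sg rs].
have [lt_ga|] := ltnP g.+1 a.
  right; exists a, g, s; split.
    split; rewrite ?mem_head ?inE ?eqxx ?orbT //.
    move=> x; rewrite !inE => /or3P[/eqP->|/eqP->|/(allP sg)] /=; lia.
  left; split=> //; rewrite !inE !negb_or; apply/and3P; split; try lia.
  by apply/negP => /(allP sg) /=; lia.
move=> le_ag; have {le_ag ga} -> : a = g.+1 by lia.
case: s sa sg rs => [|h s] //=.
  move=> _ _ _; left; split; last by constructor 3; exists g.
  case=> [x y] [x' y']; rewrite /points /= !inE /cone_cmp /cone_le /=; lia.
rewrite reduced_cons => /andP[_ sa] /andP[hg sg] /and3P[h0 sh rs].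
right; exists g.+1, h, s; split; last by right.
split; rewrite ?inE ?eqxx ?orbT //.
move=> x; rewrite !inE => /or4P[/eqP->|/eqP->|/eqP->|/(allP sh)] /=; lia.
Qed.

(** * Isomorphisms and the two forks *)

(** Both possible complements are chains, either the points of height zero or
    the first part of the line of a.  This is the constraint that a fork of an
    isomorphic poset must meet. *)
Lemma not_above_fork a g s p (s' := [:: a, g & s]) :
    reduced s' -> branching s' a g -> fork (points s') p ->
  (forall q r, points s' q -> points s' r ->
     ~~ cone_le p q -> ~~ cone_le p r -> cone_cmp q r) /\
  exists2 t, forall q, points s' q -> ~~ cone_le p q -> q \in t
           & size t <= maxn (size s') (a - g).
Proof.
move=> rs' bs fp; have [_ _ g0 ga gap] := bs.
have ss x : x \in s -> x < g.
  by move: rs'; rewrite !reduced_cons => /and3P[_ _ /and3P[_ /allP sg _]] /sg.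
have {fp} [->|->] := (branching_fork p bs).1 fp.
  split=> [[x y] [x' y']|].
    rewrite !above_left_fork // -!leqNgt /points /= !inE => sq sr gy gy'.
    have {sq} /eqP sq : (x + y).+1 == a.
      by case/or3P: sq => [//||/ss]; lia.
    have {sr} /eqP sr : (x' + y').+1 == a.
      by case/or3P: sr => [//||/ss]; lia.
    rewrite /cone_cmp /cone_le /=; lia.
  exists [seq q <- pts s' | g <= q.2].
    move=> q sq.
    by rewrite above_left_fork // -leqNgt mem_filter mem_pts sq andbT.
  rewrite size_filter count_pts_y /= subnn add0n.
  rewrite (_ : sumn _ = 0) ?addn0 ?leq_maxr //.
  elim: s {s' rs' bs gap} ss => [|x s IHs] //= ss; rewrite IHs => [|z sz].
    by have := ss _ (mem_head x s); lia.
  by apply: ss; rewrite inE sz orbT.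
split=> [[x y] [x' y'] sq sr|].
  rewrite !(above_right_fork bs) // /= -!eqn0Ngt => /eqP x0 /eqP x0'.
  rewrite /cone_cmp /cone_le /=; lia.
exists [seq q <- pts s' | q.1 == 0].
  move=> q sq; rewrite (above_right_fork bs) // -eqn0Ngt.
  by rewrite mem_filter mem_pts sq andbT.
by rewrite size_filter count_pts_x0 ?leq_maxl //; case/andP: rs'.
Qed.

(** The up-sets generated by corresponding points correspond: positive height
    on one side, depth below h on the other. *)
Lemma swap_iso s t a b g h f f' : branching s a g -> branching t b h ->
    poset_iso (points s) (points t) f f' -> f (1, a.-2) = (0, h.-1) ->
  exists F F',
    poset_iso (points (dec s)) (fun q => points t q && (q.2 < h)) F F'.
Proof.
move=> bs bt fiso fm; have [_ _ _ _ fle] := fiso.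
have [_ _ h0 _ _] := bt; have [sa _ g0 ga _] := bs.
have fab p : points s p -> (0 < p.1) = ((f p).2 < h).
  move=> sp; rewrite -(above_right_fork bs) // -above_left_fork // -fm fle //.
  by rewrite /points /= (_ : _.+1 = a) //; lia.
do 2 eexists.
exact: poset_iso_comp (dec_iso s) (poset_iso_restrict fiso fab).
Qed.

Lemma swap_size s t a b g h f f' : reduced s -> reduced t ->
    branching s a g -> branching t b h ->
    poset_iso (points s) (points t) f f' -> f (1, a.-2) = (0, h.-1) ->
  size s = sumn [seq x - h | x <- t].
Proof.
move=> rs rt bs bt fiso fm; have [_ _ _ _ fle] := fiso.
have [_ _ h0 _ _] := bt; have [sa _ g0 ga _] := bs.
rewrite -count_pts_y -count_pts_x0; last by case/andP: rs.
apply: poset_iso_count rs rt fiso _ => p sp.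
have sm1 : points s (1, a.-2) by rewrite /points /= (_ : _.+1 = a) //; lia.
rewrite leqNgt -above_left_fork // -fm fle //.
by rewrite (above_right_fork bs) // eqn0Ngt.
Qed.

Lemma straight_size s t a b g h f f' : reduced s -> reduced t ->
    branching s a g -> branching t b h ->
    poset_iso (points s) (points t) f f' -> f (1, a.-2) = (1, b.-2) ->
  size s = size t.
Proof.
move=> rs rt bs bt fiso fm; have [_ _ _ _ fle] := fiso.
have [sa _ g0 ga _] := bs; have [fY _ _ _ _] := fiso.
rewrite -!count_pts_x0; try by [case/andP: rs | case/andP: rt].
apply: poset_iso_count rs rt fiso _ => p sp.
have sm1 : points s (1, a.-2) by rewrite /points /= (_ : _.+1 = a) //; lia.
rewrite !eqn0Ngt -(above_right_fork bs) // -(above_right_fork bt) ?fY //.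
by rewrite -fm fle.
Qed.

Lemma straight_excess s t a b g h f f' : reduced s -> reduced t ->
    branching s a g -> branching t b h ->
    poset_iso (points s) (points t) f f' -> f (0, g.-1) = (0, h.-1) ->
  sumn [seq x - g | x <- s] = sumn [seq x - h | x <- t].
Proof.
move=> rs rt bs bt fiso fm; have [_ _ _ _ fle] := fiso.
have [_ sg g0 ga _] := bs; have [_ _ h0 _ _] := bt.
rewrite -!count_pts_y; apply: poset_iso_count rs rt fiso _ => p sp.
have sm2 : points s (0, g.-1) by rewrite /points /= add0n prednK.
by rewrite (leqNgt g) (leqNgt h) -!above_left_fork // -fm fle.
Qed.

(** The line of g starts at the second fork, so that only the least point of
    the poset is below a fork. *)
Lemma below_fork a g s p p' (s' := [:: a, g & s]) :
    reduced s' -> branching s' a g -> fork (points s') p ->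
  points s' p' -> cone_le p' p -> p' != p -> p' = (0, a.-1).
Proof.
move=> rs bs fp.
have ss x : x \in s -> x < g.
  by move: rs; rewrite !reduced_cons => /and3P[_ _ /and3P[_ /allP sg _]] /sg.
have [_ _ g0 ga gap] := bs; case: p' => x y.
rewrite /points /= !inE => sp le_p ne_p.
have {sp} [sp|[sp|/ss sp]] :
    (x + y).+1 = a \/ (x + y).+1 = g \/ (x + y).+1 \in s.
- by case/or3P: sp => [/eqP|/eqP|]; tauto.
- have [ep|ep] := (branching_fork p bs).1 fp; move: le_p ne_p;
    by rewrite {}ep /cone_le /= xpair_eqE => le_p ne_p; congr (_, _); lia.
- have [ep|ep] := (branching_fork p bs).1 fp; move: le_p ne_p;
    by rewrite {}ep /cone_le /= xpair_eqE => le_p ne_p; lia.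
- have [ep|ep] := (branching_fork p bs).1 fp; move: le_p ne_p;
    by rewrite {}ep /cone_le /= xpair_eqE => le_p ne_p; lia.
Qed.

(** When b - 1 is a size, two points lie below the forks, which
    [below_fork] excludes on the other side. *)
Lemma loose_iso a g s' t b h f f' (s := [:: a, g & s']) :
    reduced s -> branching s a g -> branching t b h ->
    poset_iso (points s) (points t) f f' -> b.-1 \notin t.
Proof.
move=> rs bs bt /poset_iso_sym fiso; apply/negP => tb1.
have [tb th h0 hb _] := bt; have [gY _ gK _ gle] := fiso.
have tm1 : points t (1, b.-2) by rewrite /points /= (_ : _.+1 = b) //; lia.
have tb0 : points t (0, b.-1) by rewrite /points /= (_ : _.+1 = b) //; lia.
have tb1' : points t (0, b.-2) by rewrite /points /= (_ : _.+1 = b.-1) //; lia.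
have ff : fork (points s) (f' (1, b.-2)).
  by apply: fork_iso fiso _; apply/(branching_fork _ bt); right.
have below q : points t q -> cone_le q (1, b.-2) -> q != (1, b.-2) ->
    f' q = (0, a.-1).
  move=> tq le_q ne_q; apply: below_fork rs bs ff (gY _ tq) _ _.
    by rewrite gle.
  by apply: contraNneq ne_q => e; rewrite -(gK q) // e gK.
have e0 : f' (0, b.-1) = (0, a.-1).
  by apply: below => //; rewrite /cone_le /=; lia.
have e1 : f' (0, b.-2) = (0, a.-1).
  by apply: below => //; rewrite /cone_le /=; lia.
have: (0, b.-1) = (0, b.-2) by rewrite -(gK (0, b.-1)) // e0 -e1 gK.
by case; lia.
Qed.

Lemma reduced_tail a g s x : reduced [:: a, g & s] -> x \in s -> 0 < x < g.
Proof.
rewrite !reduced_cons => /and3P[_ _ /and3P[_ /allP sg rs]] sx.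
by apply/andP; split; [exact: reduced_gt0 rs sx | exact: sg sx].
Qed.

(** If g = 1, then the decreased sizes form a single line, which has no fork. *)
Lemma dec_branching a g s' p (s := [:: a, g & s']) :
    reduced s -> branching s a g -> fork (points (dec s)) p ->
  dec s = [:: a.-1, g.-1 & dec s'] /\ branching (dec s) a.-1 g.-1.
Proof.
move=> rs [_ _ g0 ga _] fp.
have g1 : 1 < g.
  have [_ [q sq npq] _] := fp; move: sq npq; have [sp _ _] := fp.
  move: sp; rewrite !points_dec /points.
  case: p q {fp} => [x y] [x' y'] /=; rewrite !inE !addSn ltnNge => sp sq npq.
  apply/negP => g1; case/negP: npq.
  have {}sp : (x + y).+2 = a.
    by case/or3P: sp => [/eqP //|/eqP|/(reduced_tail rs)]; lia.
  have {}sq : (x' + y').+2 = a.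
    by case/or3P: sq => [/eqP //|/eqP|/(reduced_tail rs)]; lia.
  clear -sp sq; rewrite /cone_cmp /cone_le /=; lia.
have eds : dec s = [:: a.-1, g.-1 & dec s'].
  by rewrite !dec_cons g1; case: ltnP => //; lia.
split=> //; split; rewrite ?eds ?mem_head ?inE ?eqxx ?orbT //; try lia.
have := reduced_dec rs; rewrite eds => rds x.
by rewrite !inE => /or3P[/eqP->|/eqP->|/(reduced_tail rds)]; lia.
Qed.

(** In the part of depth less than h the line of b begins at (b-h, h-1), just
    above the least point (0, h-1) and incomparable with (0, d-1). *)
Lemma truncated_fork b h d t' (t := [:: b, h, d & t']) :
    reduced t -> branching t b h ->
  fork (fun q => points t q && (q.2 < h)) (b - h, h.-1).
Proof.
move=> rt [_ _ h0 hb _].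
have dh : 0 < d < h by apply: (reduced_tail rt); rewrite mem_head.
split; rewrite /points /=.
- by rewrite (_ : _.+1 = b) ?mem_head //=; lia.
- exists (0, d.-1); last by rewrite /cone_cmp /cone_le /=; lia.
  by rewrite /= (_ : _.+1 = d) ?inE ?eqxx ?orbT //=; lia.
case=> [x y] /andP[/= tp yh]; rewrite /cone_le /= xpair_eqE => le_p ne_p.
have x0 : x = 0.
  by move: tp; rewrite in_cons inE => /or3P[| |/(reduced_tail rt)]; lia.
case=> [x' y'] /andP[/= _ yh']; clear -x0 yh yh' le_p.
rewrite /cone_cmp /cone_le /=; lia.
Qed.

(** The fork of [truncated_fork] corresponds to a fork of the decreased sizes
    of s, so the points that are not above it form a chain.  Two of them are
    (1, h-2) and (0, x-1) for each remaining size x, and their comparability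
    forces x = h - 1.  If h > 2, then the chain has at least four points, more
    than the second kind of complement allows, so that it is of the first kind
    and s has at least four entries. *)
Lemma swap_loose a g s' b h t' f f'
    (s := [:: a, g & s']) (t := [:: b, h & t']) :
    reduced s -> reduced t -> branching s a g -> branching t b h ->
    size t = a - g ->
    poset_iso (points s) (points t) f f' -> f (1, a.-2) = (0, h.-1) ->
  t' = [::] \/ t' = [:: h.-1] /\ (h = 2 \/ 4 <= size s).
Proof.
move=> rs rt bs bt szt fiso fm.
have [F [F' Fiso]] := swap_iso bs bt fiso fm.
have tt x : x \in t' -> 0 < x < h by exact: reduced_tail rt.
have [et|[d [l et]]] : t' = [::] \/ exists d l, t' = d :: l.
- by case: (t') => [|d l]; [left | right; exists d, l].
- by left.
have t'd : d \in t' by rewrite et mem_head.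
have := truncated_fork (b := b) (h := h) (d := d) (t' := l).
rewrite -et -/t => /(_ rt bt) fq; have := dec_branching rs bs.
have fp := fork_iso (poset_iso_sym Fiso) fq; move=> /(_ _ fp) [eds bds].
have rds := reduced_dec rs; have szds := size_dec s.
rewrite eds in rds bds szds Fiso fp.
have [ch [u uP szu]] := not_above_fork rds bds fp.
have e3 : a.-1 - g.-1 = size t by case: bds => _ _ *; lia.
rewrite {}e3 in szu; move: szu szds ch uP {fp bds rds eds}.
(* of the decreased sizes only their number matters below *)
move: [:: a.-1, g.-1 & dec s'] Fiso => ds Fiso szu szds ch uP.
have [FY GX FK GK Fle] := Fiso; have [_ _ _ _ Gle] := poset_iso_sym Fiso.
move: Fiso FY GX FK GK Fle Gle fq ch uP.
set Q := (fun q => points t q && (q.2 < h)); set q := (b - h, h.-1).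
move=> Fiso FY GX FK GK Fle Gle fq ch uP; have [Qq _ _] := fq.
have bh : 1 < b - h by case: bt => _ _ *; lia.
have th : h \in t by rewrite !inE eqxx orbT.
have Q0 x : x \in t -> 0 < x <= h -> Q (0, x.-1).
  move=> tx xh; rewrite /Q /points /= (_ : _.+1 = x) ?tx //=; clear -xh; lia.
have Q1 x : x \in t -> 1 < x <= h -> Q (1, x.-2).
  move=> tx xh; rewrite /Q /points /= (_ : _.+1 = x) ?tx //=; clear -xh; lia.
have nq x y : x < 2 -> cone_le q (x, y) = false.
  by rewrite /cone_le /=; clear -bh; lia.
have t't x : x \in t' -> x \in t by rewrite !inE => ->; rewrite !orbT.
have t'h x : x \in t' -> x = h.-1.
  move=> t'x; have xh := tt x t'x.
  have Qx : Q (0, x.-1) by apply: Q0; [exact: t't | clear -xh; lia].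
  have Qh : Q (1, h.-2) by apply: Q1 => //; clear -xh; lia.
  have := ch _ _ (GX _ Qx) (GX _ Qh).
  rewrite !Gle // !nq // => /(_ isT isT); rewrite /cone_cmp !Gle //.
  by rewrite /cone_le /=; clear -xh; lia.
right; have et' : t' = [:: h.-1].
  have := reduced_uniq rt; rewrite /t et /= => /and3P[_ _ /andP[dl ul]].
  rewrite -(t'h d) //; case: l et dl {ul} => // x l et; rewrite inE.
  have t'x : x \in t' by rewrite et !inE eqxx orbT.
  by rewrite (t'h d t'd) (t'h x t'x) eqxx.
split=> //; have [->|h2] := eqVneq h 2; [by left | right].
have h3 : h.-1 \in t' by rewrite et' mem_head.
have h1 := tt _ h3; have th1 := t't _ h3.
(* four points of the chain of points that are not above the fork *)
pose v := [:: (0, h.-1); (1, h.-2); (0, h.-2); (1, h.-1.-2)].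
have Qv r : r \in v -> Q r && ~~ cone_le q r.
  rewrite !inE => /or4P[] /eqP ->; rewrite nq // andbT.
  - by apply: Q0 => //; clear -h1; lia.
  - by apply: Q1 => //; clear -h1; lia.
  - by apply: Q0 => //; clear -h1; lia.
  - by apply: Q1 => //; clear -h1 h2; lia.
have uv : uniq v by rewrite /= !inE !xpair_eqE /=; clear -h1 h2; lia.
have: size v <= size u.
  rewrite -(size_map F'); apply: uniq_leq_size.
    rewrite map_inj_in_uniq // => r r' /Qv /andP[Qr _] /Qv /andP[Qr' _] e.
    by rewrite -(GK r) // e GK.
  by move=> _ /mapP[r /Qv /andP[Qr qr] ->]; apply: uP; rewrite ?GX ?Gle.
move=> szv; have := leq_trans szv szu; rewrite /t et' /=.
by clear -szds; move: szds; rewrite /=; lia.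
Qed.

(** The two largest decreased sizes differ by one, so that their poset has,
    besides its least point, a point below all others.  In the part of depth
    less than h of the other poset only the least point is below both
    (b-1-h, h-1) and (0, d-1). *)
Lemma swap_tight a g s' b h t' f f'
    (s := [:: a, a.-1, g & s']) (t := [:: b, b.-1, h & t']) :
    reduced s -> reduced t -> branching s a g -> branching t b h ->
    poset_iso (points s) (points t) f f' -> f (1, a.-2) = (0, h.-1) ->
  t' = [::].
Proof.
move=> rs rt bs bt fiso fm.
have [F [F' Fiso]] := swap_iso bs bt fiso fm.
have [FY GX FK GK Fle] := Fiso.
have [_ _ _ _ Gle] := poset_iso_sym Fiso.
have [_ sg g0 ga gap] := bs; have [tb th h0 hb _] := bt.
clear fiso fm; case: t' @t rt tb th bt Fiso FY GX FK GK Fle Gle => // d l t.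
move=> rt tb th bt Fiso FY GX FK GK Fle Gle; exfalso.
have dh : 0 < d < h.
  move: (rt); rewrite !reduced_cons /= => /and5P[_ _ _ _].
  by move=> /and3P[_ /andP[-> _] /andP[-> _]].
pose p0 := (0, a.-2); pose p1 := (0, a.-1.-2).
have sp0 : points (dec s) p0.
  rewrite points_dec /points /= (_ : _.+1 = a) ?mem_head //.
  by clear -ga g0; lia.
have sp1 : points (dec s) p1.
  rewrite points_dec /points /= (_ : _.+1 = a.-1) ?inE ?eqxx ?orbT //.
  by clear -ga g0; lia.
have p0min z : points (dec s) z -> cone_le p0 z.
  rewrite points_dec /points => /gap; rewrite /cone_le /=; lia.
have p1min z : points (dec s) z -> z != p0 -> cone_le p1 z.
  case: z => x y; rewrite points_dec /points => /gap.
  rewrite /cone_le /= xpair_eqE; lia.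
set Q := (fun q => points t q && (q.2 < h)) in Fiso FY GX FK GK Fle Gle.
have Q0 : Q (0, h.-1).
  by rewrite /Q /points /= (_ : _.+1 = h) ?th //=; clear -h0; lia.
have Q1 : Q (b.-1 - h, h.-1).
  rewrite /Q /points /= (_ : _.+1 = b.-1) ?inE ?eqxx ?orbT //=;
    clear -h0 hb; lia.
have Q2 : Q (0, d.-1).
  by rewrite /Q /points /= (_ : _.+1 = d) ?inE ?eqxx ?orbT //=; clear -dh; lia.
have Fp0 : F p0 = (0, h.-1).
  have := FY _ sp0; have : cone_le (F p0) (0, h.-1).
    by rewrite -(GK (0, h.-1)) // Fle ?GX // p0min ?GX.
  case: (F p0) => x y; rewrite /Q /cone_le /= => le_p /andP[_ yh].
  by clear -le_p yh; congr (_, _); lia.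
have above z : Q z -> z != (0, h.-1) -> cone_le (F p1) z.
  move=> Qz nz; rewrite -(GK z) // Fle ?GX // p1min ?GX //.
  by apply: contraNneq nz => e; rewrite -(GK z) // e Fp0.
have /eqP[] : p1 != p0 by rewrite xpair_eqE /=; clear -ga g0; lia.
rewrite -(FK p1) // -(FK p0) // Fp0; congr (F' _).
have := above _ Q1; have := above _ Q2; have := FY _ sp1.
case: (F p1) => x y; rewrite /Q /cone_le /= !xpair_eqE => /andP[_ yh] l1 l2.
clear -yh l1 l2 hb h0 dh; by congr (_, _); lia.
Qed.

(** * Classification of the posets *)

Definition segre_related (s t : seq nat) :=
  [\/ (s = [:: 5; 2] /\ t = [:: 4; 2; 1]) \/
      (s = [:: 4; 2; 1] /\ t = [:: 5; 2]),
      exists2 l : nat, 2 <= l &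
        (s = [:: l; l - 1] /\ t = [:: 2 * l - 1]) \/
        (s = [:: 2 * l - 1] /\ t = [:: l; l - 1])
    | s = t].

Lemma segre_related_sym s t : segre_related s t -> segre_related t s.
Proof.
case=> [st|[l l2 st]|->]; last by constructor 3.
  by constructor 1; case: st => [[-> ->]|[-> ->]]; [right | left].
by constructor 2; exists l => //; case: st => [[-> ->]|[-> ->]]; [right | left].
Qed.

Lemma classify_chain s t : reduced s -> reduced t ->
    [\/ s = [::], exists a, s = [:: a] | exists a, s = [:: a.+1; a]] ->
    [\/ t = [::], exists a, t = [:: a] | exists a, t = [:: a.+1; a]] ->
  sumn s = sumn t -> segre_related s t.
Proof.
move=> rs rt; case=> [es|[a es]|[a es]] [et|[b et]|[b et]];
  move: rs rt; rewrite es et /reduced /= => rs rt e; try lia.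
- by constructor 3.
- by constructor 3; congr [:: _]; lia.
- constructor 2; exists b.+1; first lia.
  by right; split; [congr [:: _] | congr [:: _; _]]; lia.
- constructor 2; exists a.+1; first lia.
  by left; split; [congr [:: _; _] | congr [:: _]]; lia.
- by constructor 3; congr [:: _; _]; lia.
Qed.

Lemma dec_inj s t : reduced s -> reduced t -> size s = size t ->
  dec s = dec t -> s = t.
Proof.
move=> rs rt sz e.
by case: (dec_split rs) (dec_split rt) => [es|es] [et|et]; rewrite es et e //;
  move: sz; rewrite es et e size_rcons; lia.
Qed.

(** Increasing the sizes again, and adding the size 1 where it was lost, must
    give lists of equal length.  This makes lists with equal decreases equal,
    and turns (5, 2), (4, 2, 1) into (6, 3, 1), (5, 3, 2), where 3 and 2 points
    are not above the second fork. *)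
Lemma classify_straight s t a b g h s' t' : reduced s -> reduced t ->
    branching s a g -> branching t b h ->
    branching_list s a g s' ->
    branching_list t b h t' ->
    size s = size t ->
    sumn [seq x - g | x <- s] = sumn [seq x - h | x <- t] ->
  segre_related (dec s) (dec t) -> segre_related s t.
Proof.
move=> rs rt bs bt ss tt sz sg; case; last first.
- by move=> e; constructor 3; apply: dec_inj e.
(* The list whose decreased sizes are (l, l-1) branches only when it also
   contains 1, and then it is longer than the other one. *)
- suff short u a' g' u' v l : 1 < l -> reduced u -> reduced v ->
      branching u a' g' ->
      branching_list u a' g' u' ->
      size u = size v ->
      dec u = [:: l; l - 1] -> dec v = [:: 2 * l - 1] -> False.
    move=> [l l2 [[e e']|[e e']]]; exfalso.
      exact: short l2 rs rt bs ss sz e e'.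
    exact: short l2 rt rs bt tt (esym sz) e' e.
  move=> l1 ru rv [_ _ _ ga _] uu szuv eu ev.
  case: (dec_split ru) (dec_split rv) => [eu'|eu'] [ev'|ev'];
    move: szuv; rewrite eu' ev' eu ev //= => _.
  move: uu; rewrite eu' eu /= => -[[[ea eg _] _]|//]; lia.
move=> e; exfalso.
suff exc u v a' b' g' h' u' v' : reduced u -> reduced v ->
      branching u a' g' -> branching v b' h' ->
    branching_list u a' g' u' ->
    branching_list v b' h' v' ->
    size u = size v ->
    sumn [seq x - g' | x <- u] = sumn [seq x - h' | x <- v] ->
    dec u = [:: 5; 2] -> dec v = [:: 4; 2; 1] -> False.
  case: e => [[e e']|[e e']]; first exact: exc rs rt bs bt ss tt sz sg e e'.
  exact: exc rt rs bt bs tt ss (esym sz) (esym sg) e' e.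
move=> ru rv _ _ uu vv szuv + eu ev.
move: uu vv szuv; case: (dec_split ru) => ->; case: (dec_split rv) => ->;
  rewrite eu ev //= => uu vv _.
have {uu} eg : g' = 3 by case: uu => [[[_ <-]]|[<-]].
have {vv} eh : h' = 3 by case: vv => [[[_ <-]]|[<-]].
by rewrite eg eh.
Qed.

(** By symmetry the constraints hold on both sides and leave lists of two or
    three entries; the counts of points that are not above a fork give the first
    gap, and the number of all points then gives the sizes. *)
Lemma classify_swap s t a b g h s' t' f f' : reduced s -> reduced t ->
    branching s a g -> branching t b h ->
    branching_list s a g s' ->
    branching_list t b h t' ->
    poset_iso (points s) (points t) f f' ->
    f (1, a.-2) = (0, h.-1) -> f' (1, b.-2) = (0, g.-1) ->
  segre_related s t.
Proof.
move=> rs rt bs bt ss tt fiso fm fm'.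
have fiso' := poset_iso_sym fiso.
have sz := swap_size rs rt bs bt fiso fm.
have sz' := swap_size rt rs bt bs fiso' fm'.
have sm := poset_iso_sumn rs rt fiso.
have sum0 u c : (forall x, x \in u -> x <= c) -> sumn [seq x - c | x <- u] = 0.
  elim: u => [|x u IHu] //= uc; rewrite IHu => [|z zu]; last first.
    by apply: uc; rewrite inE zu orbT.
  by have := uc x (mem_head x u); lia.
have tail u c d : reduced [:: c, d & u] -> forall x, x \in d :: u -> x <= d.
  rewrite !reduced_cons => /and3P[_ _ /and3P[_ /allP du _]] x.
  by rewrite inE => /orP[/eqP-> //|/du /=]; lia.
have [_ _ g0 ga _] := bs; have [_ _ h0 hb _] := bt.
case: ss tt => [[es sa]|es] [[et tb]|et].
- subst s t; rewrite /= (sum0 t') ?subnn in sz; last first.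
    by move=> x tx; apply: (tail _ _ _ rt); rewrite inE tx orbT.
  rewrite /= (sum0 s') ?subnn in sz'; last first.
    by move=> x tx; apply: (tail _ _ _ rs); rewrite inE tx orbT.
  have szt : size [:: b, h & t'] = a - g by rewrite /= sz'; lia.
  have szs : size [:: a, g & s'] = b - h by rewrite /= sz; lia.
  have [et|[et h2]] := swap_loose rs rt bs bt szt fiso fm;
  have [es|[es g2]] := swap_loose rt rs bt bs szs fiso' fm';
    move: szs szt sm; rewrite et es /= => szs szt sm.
  + by constructor 3; congr [:: _; _]; lia.
  + by constructor 1; right; split; [congr [:: _; _; _] | congr [:: _; _]];
      move: g2; rewrite et /=; lia.
  + by constructor 1; left; split; [congr [:: _; _] | congr [:: _; _; _]];
      move: h2; rewrite es /=; lia.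
  + constructor 3; move: g2 h2; rewrite es et /=.
    by move=> g2 h2; congr [:: _; _; _]; lia.
- exfalso; subst s; have := loose_iso rs bs bt fiso.
  by rewrite et !inE eqxx orbT.
- exfalso; subst t; have := loose_iso rt bt bs fiso'.
  by rewrite es !inE eqxx orbT.
subst s t.
have et := swap_tight rs rt bs bt fiso fm.
have es := swap_tight rt rs bt bs fiso' fm'.
move: sz sz' sm; rewrite et es /= => sz sz' sm.
by constructor 3; congr [:: _; _; _]; lia.
Qed.

Lemma branching_not_chain s a g : branching s a g -> ~ chain_poset (points s).
Proof.
move=> bs cs.
have [_ [q sq npq] _] := (branching_fork _ bs).2 (or_introl erefl).
by case/negP: npq; apply: cs => //; case: bs => _ sg g0 _ _;
   rewrite /points /= add0n prednK.
Qed.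

Lemma classify N s t f f' : reduced s -> reduced t ->
    (forall x, x \in s -> x <= N) ->
  poset_iso (points s) (points t) f f' -> segre_related s t.
Proof.
elim: N => [|N IHN] in s t f f' *; move=> rs rt sN fiso;
  have sm := poset_iso_sumn rs rt fiso;
  (have [[cs shs]|[a [g [s' [bs ss]]]]] := reduced_shape rs);
  (have [[ct sht]|[b [h [t' [bt tt]]]]] := reduced_shape rt);
  try by [exact: classify_chain
    | case: (branching_not_chain bs);
      apply: chain_poset_iso (poset_iso_sym fiso) ct
    | case: (branching_not_chain bt); apply: chain_poset_iso fiso cs].
  by case: bs => /sN; lia.
have fiso' := poset_iso_sym fiso.
have [fY gX fK gK fle] := fiso.
have f1 := (branching_fork _ bs).2 (or_intror erefl).
have f2 := (branching_fork _ bs).2 (or_introl erefl).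
have [sm1 _ _] := f1; have [sm2 _ _] := f2.
have m12 : f (1, a.-2) <> f (0, g.-1).
  by move=> e; have := fK _ sm1; rewrite e fK.
have e1 := (branching_fork _ bt).1 (fork_iso fiso f1).
have e2 := (branching_fork _ bt).1 (fork_iso fiso f2).
have [e1'|e1'] := e1.
  have e2' : f (0, g.-1) = (1, b.-2).
    by have [e|//] := e2; case: m12; rewrite e1' e.
  by apply: (classify_swap rs rt bs bt ss tt fiso e1'); rewrite -e2' fK.
have {}e2 : f (0, g.-1) = (0, h.-1).
  by have [//|e] := e2; case: m12; rewrite e1' e.
apply: (classify_straight rs rt bs bt ss tt).
- exact: straight_size rs rt bs bt fiso e1'.
- exact: straight_excess rs rt bs bt fiso e2.
have fab p : points s p -> (0 < p.1) = (0 < (f p).1).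
  move=> sp; rewrite -(above_right_fork bs) // -(above_right_fork bt) ?fY //.
  by rewrite -e1' fle.
have diso := poset_iso_comp
  (poset_iso_comp (dec_iso s) (poset_iso_restrict fiso fab))
  (poset_iso_sym (dec_iso t)).
apply: IHN (reduced_dec rs) (reduced_dec rt) _ diso => x.
by rewrite mem_dec => /andP[_ /sN].
Qed.

Lemma poset_iso_refl s : poset_iso (points s) (points s) id id.
Proof. by []. Qed.

(** The lines of l and l - 1 interleave; the k-th point of the chain has height
    half of k, and by symmetry its depth is half the number of points above. *)
Lemma two_chains_iso l : 1 < l ->
  poset_iso (points [:: l; l - 1]) (points [:: 2 * l - 1])
    (fun p => (p.1 + (l.-1 - p.2), p.2 + (l.-1 - p.1)))
    (fun p => (p.1./2, p.2./2)).
Proof.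
move=> l1; rewrite /points; split.
- by case=> x y /=; rewrite !inE; lia.
- by case=> x y /=; rewrite !inE; lia.
- by case=> x y /=; rewrite !inE => xy; congr (_, _); lia.
- by case=> x y /=; rewrite !inE => xy; congr (_, _); lia.
by case=> [x y] [x' y'] /=; rewrite !inE /cone_le /= => xy xy'; lia.
Qed.

(** The two lists are matched entry by entry: the line of 5 becomes the chain
    through the ends of the line of 4 and the lines of 2 and 1, the line of 2
    becomes the interior of the line of 4. *)
Definition nodes52 :=
  [:: (0, 4); (1, 3); (2, 2); (3, 1); (4, 0); (0, 1); (1, 0)].
Definition nodes421 :=
  [:: (0, 3); (0, 1); (0, 0); (1, 0); (3, 0); (1, 2); (2, 1)].

Lemma iso52_421 :
  poset_iso (points [:: 5; 2]) (points [:: 4; 2; 1])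
    (fun p => nth p nodes421 (index p nodes52))
    (fun p => nth p nodes52 (index p nodes421)).
Proof.
have n52 p : points [:: 5; 2] p = (p \in nodes52).
  by rewrite -mem_pts; apply/(perm_mem (s1 := pts _) (s2 := nodes52)).
have n421 p : points [:: 4; 2; 1] p = (p \in nodes421).
  by rewrite -mem_pts; apply/(perm_mem (s1 := pts _) (s2 := nodes421)).
set f := fun p => nth p nodes421 _; set g := fun p => nth p nodes52 _.
have fP : all (fun p => (f p \in nodes421) && (g (f p) == p)) nodes52 by [].
have gP : all (fun p => (g p \in nodes52) && (f (g p) == p)) nodes421 by [].
have le_f : all (fun p => all (fun q =>
  cone_le (f p) (f q) == cone_le p q) nodes52) nodes52 by [].
split=> [p|p|p|p|p q]; rewrite ?n52 ?n421.
- by case/(allP fP)/andP.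
- by case/(allP gP)/andP.
- by case/(allP fP)/andP=> _ /eqP.
- by case/(allP gP)/andP=> _ /eqP.
by move=> /(allP le_f)/allP /[apply] /eqP.
Qed.

Lemma segre_related_iso s t : segre_related s t ->
  exists f g, poset_iso (points s) (points t) f g.
Proof.
case=> [[[-> ->]|[-> ->]]|[l l2 [[-> ->]|[-> ->]]]|->].
- by do 2 eexists; exact: iso52_421.
- by do 2 eexists; exact: poset_iso_sym iso52_421.
- by do 2 eexists; exact: two_chains_iso.
- by do 2 eexists; apply: poset_iso_sym; exact: two_chains_iso.
by exists id, id; exact: poset_iso_refl.
Qed.

Theorem points_iso_related s t : reduced s -> reduced t ->
  (exists f g, poset_iso (points s) (points t) f g) <-> segre_related s t.
Proof.
move=> rs rt; split=> [[f [g fiso]]|]; last exact: segre_related_iso.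
apply: (@classify (\max_(x <- s) x) _ _ _ _ rs rt _ fiso) => x sx.
exact: leq_bigmax_seq.
Qed.

(** * Lattices of down-sets *)

(** What characterizes L as the lattice of down-sets of X, with [pr p] the
    down-set generated by p: the generators have the order of X, are join-prime,
    determine the order of L, and every down-set is represented. *)
Definition principal_family (d : Order.disp_t) (L : latticeType d)
    (X : pred (nat * nat)) (pr : nat * nat -> L) :=
  [/\ forall p q, X p -> X q -> (pr p <= pr q)%O = cone_le p q,
      forall p u v, X p -> (pr p <= u `|` v)%O ->
        (pr p <= u)%O || (pr p <= v)%O,
      forall u v, (forall p, X p -> (pr p <= u)%O -> (pr p <= v)%O) ->
        (u <= v)%O
    & forall D : pred (nat * nat),
        (forall p q, X p -> X q -> cone_le p q -> D q -> D p) ->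
        exists u, forall p, X p -> (pr p <= u)%O = D p].

Section PrincipalFamily.
Variables (d : Order.disp_t) (L : latticeType d) (X : pred (nat * nat)).
Variable pr : nat * nat -> L.
Hypothesis prP : principal_family X pr.

Lemma pr_joinE p u v : X p ->
  (pr p <= u `|` v)%O = (pr p <= u)%O || (pr p <= v)%O.
Proof.
have [_ prU _ _] := prP; move=> Xp; apply/idP/idP; first exact: prU.
by case/orP=> le_u; apply: le_trans le_u _; rewrite (leUl, leUr).
Qed.

Lemma pr_ext u v : (forall p, X p -> (pr p <= u)%O = (pr p <= v)%O) -> u = v.
Proof.
have [_ _ pr_le _] := prP; move=> uv; apply: le_anti; apply/andP.
by split; apply: pr_le => p Xp; rewrite uv.
Qed.

Lemma pr_inj p q : X p -> X q -> pr p = pr q -> p = q.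
Proof.
have [pr_mono _ _ _] := prP; move=> Xp Xq e.
by apply: cone_le_anti; rewrite -pr_mono // e.
Qed.

End PrincipalFamily.

Lemma maximal_point (s : seq (nat * nat)) (D : pred (nat * nat)) :
  has D s -> exists2 q, q \in s /\ D q &
    forall r, r \in s -> D r -> cone_le q r -> r = q.
Proof.
move=> hD.
(* x - y strictly increases along the order; N keeps it a natural number *)
pose N := \max_(q <- s) q.2; pose w q := q.1 + (N - q.2).
have sN q : q \in s -> q.2 <= N.
  by move=> sq; apply: (@leq_bigmax_seq _ s xpredT (fun q => q.2)).
pose P n := has (fun q => D q && (w q == n)) s.
have exP : exists n, P n.
  case/hasP: hD => q sq Dq; exists (w q).
  by apply/hasP; exists q; rewrite ?Dq /=.
have ubP n : P n -> n <= \max_(q <- s) w q.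
  by case/hasP=> q sq /andP[_ /eqP<-]; apply: (@leq_bigmax_seq _ s xpredT w).
case: (ex_maxnP exP ubP) => m /hasP[q sq /andP[Dq /eqP wq]] maxm.
exists q => // r sr Dr qr; apply: cone_le_anti => //.
have: w r <= m by apply: maxm; apply/hasP; exists r; rewrite ?Dr /=.
have := sN _ sr; have := sN _ sq; move: qr; rewrite -wq /w /cone_le.
by case: q r {sq Dq wq sr Dr} => [x y] [x' y'] /=; lia.
Qed.

(** Remove a maximal point q from the down-set of z: z is below the join of
    the remaining part and of [pr q], hence below [pr q]. *)
Lemma principal_of_prime d (L : latticeType d) s (pr : nat * nat -> L) (z : L) :
    principal_family (points s) pr ->
    (exists v, ~~ (z <= v)%O) ->
    (forall u v, (z <= u `|` v)%O -> (z <= u)%O || (z <= v)%O) ->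
  exists2 q, points s q & pr q = z.
Proof.
move=> prP [v0 zv0] zU; have [pr_mono _ pr_le pr_ex] := prP.
pose D q := (pr q <= z)%O.
have hD : has D (pts s).
  apply: contraNT zv0 => /hasPn nD; apply: pr_le => q sq Dq.
  by have := nD q; rewrite mem_pts => /(_ sq); rewrite /D Dq.
have [q [sq Dq] qmax] := maximal_point hD; rewrite mem_pts in sq.
have [|u uD] := pr_ex (fun r => D r && (r != q)).
  move=> p r sp sr pr_r /andP[Dr rq]; apply/andP; split.
    by apply: le_trans Dr; rewrite pr_mono.
  by apply: contraNneq rq => epq; rewrite (qmax r) ?mem_pts // -epq.
exists q => //; apply: le_anti; rewrite [(_ <= z)%O]Dq.
have /zU : (z <= u `|` pr q)%O.
  apply: pr_le => r sr Dr; rewrite (pr_joinE prP) // uD // [D r]Dr.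
  by case: eqP => //= ->.
case/orP=> // zu; have: (pr q <= u)%O by exact: le_trans zu.
by rewrite uD // eqxx andbF.
Qed.

Lemma lattice_iso_of_poset_iso d d' (L : latticeType d) (L' : latticeType d')
    X Y (pr : nat * nat -> L) (pr' : nat * nat -> L') f g :
    principal_family X pr -> principal_family Y pr' -> poset_iso X Y f g ->
  lattice_isomorphic L L'.
Proof.
move=> prP prP' [fY gX fK gK fle].
have [pr_mono _ _ pr_ex] := prP; have [pr_mono' _ _ pr_ex'] := prP'.
have exF u : exists v, forall q, Y q -> (pr' q <= v)%O = (pr (g q) <= u)%O.
  apply: pr_ex' => p q Yp Yq pq; apply: le_trans.
  by rewrite pr_mono ?gX // -fle ?gX // !gK.
have exG v : exists u, forall p, X p -> (pr p <= u)%O = (pr' (f p) <= v)%O.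
  apply: pr_ex => p q Xp Xq pq; apply: le_trans.
  by rewrite pr_mono' ?fY // fle.
pose F u := sval (cid (exF u)); pose G v := sval (cid (exG v)).
have FE u q : Y q -> (pr' q <= F u)%O = (pr (g q) <= u)%O.
  exact: (svalP (cid (exF u))).
have GE v p : X p -> (pr p <= G v)%O = (pr' (f p) <= v)%O.
  exact: (svalP (cid (exG v))).
exists F; split.
- exists G => u.
    by apply: (pr_ext prP) => p Xp; rewrite GE // FE ?fY // fK.
  by apply: (pr_ext prP') => q Yq; rewrite FE // GE ?gX // gK.
- by move=> u v; apply: (pr_ext prP') => q Yq; rewrite FE // !lexI !FE.
- move=> u v; apply: (pr_ext prP') => q Yq.
  by rewrite FE // (pr_joinE prP') // (pr_joinE prP) ?gX // !FE.
Qed.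

(** Being join-prime and not below everything is a lattice property, and the
    points are the elements that have it. *)
Lemma poset_iso_of_lattice_iso d d' (L : latticeType d) (L' : latticeType d')
    s t (pr : nat * nat -> L) (pr' : nat * nat -> L') :
    principal_family (points s) pr -> principal_family (points t) pr' ->
    lattice_isomorphic L L' ->
  exists f g, poset_iso (points s) (points t) f g.
Proof.
move=> prP prP' [F [[G FK GK] FI FU]].
have [pr_mono prU _ pr_ex] := prP; have [pr_mono' prU' _ pr_ex'] := prP'.
have F_mono u v : (F u <= F v)%O = (u <= v)%O.
  by rewrite !leEmeet -FI (can_eq FK).
have GU u v : G (u `|` v)%O = (G u `|` G v)%O.
  by apply: (can_inj FK); rewrite FU !GK.
have F_le u v : (F u <= v)%O = (u <= G v)%O by rewrite -{1}(GK v) F_mono.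
have G_le u v : (G u <= v)%O = (u <= F v)%O by rewrite -F_mono GK.
have exf p : exists q, points s p -> points t q /\ pr' q = F (pr p).
  case sp: (points s p); last by exists p.
  have [||q tq e] := @principal_of_prime _ _ t pr' (F (pr p)) prP'.
  - have [//|u uP] := pr_ex pred0; exists (F u).
    by rewrite F_mono uP.
  - by move=> u v; rewrite !F_le GU; apply: prU.
  by exists q.
have exg q : exists p, points t q -> points s p /\ pr p = G (pr' q).
  case tq: (points t q); last by exists q.
  have [||p sp e] := @principal_of_prime _ _ s pr (G (pr' q)) prP.
  - have [//|v vP] := pr_ex' pred0; exists (G v).
    by rewrite G_le GK vP.
  - by move=> u v; rewrite !G_le FU; apply: prU'.
  by exists p.
pose f p := sval (cid (exf p)); pose g q := sval (cid (exg q)).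
have fP p : points s p -> points t (f p) /\ pr' (f p) = F (pr p).
  exact: (svalP (cid (exf p))).
have gP q : points t q -> points s (g q) /\ pr (g q) = G (pr' q).
  exact: (svalP (cid (exg q))).
exists f, g; split=> [p /fP[]|q /gP[]|p sp|q tq|p q sp sq] //.
- have [tfp efp] := fP p sp; have [sg eg] := gP _ tfp.
  by apply: (pr_inj prP) => //; rewrite eg efp FK.
- have [sgq egq] := gP q tq; have [tf ef] := fP _ sgq.
  by apply: (pr_inj prP') => //; rewrite ef egq GK.
have [tfp efp] := fP p sp; have [tfq efq] := fP q sq.
by rewrite -pr_mono' // efp efq F_mono pr_mono.
Qed.

(** * Hyperinvariant subspaces in a Jordan basis *)

Local Open Scope ring_scope.
Lemma sum_neq0 (V : nmodType) (I : finType) (f : I -> V) :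
  \sum_i f i != 0 -> exists i, f i != 0.
Proof.
move=> f0; apply/existsP; apply: contraNT f0 => /existsPn f0.
by rewrite big1 // => i _; apply/eqP; rewrite -[_ == _]negbK.
Qed.

Section JordanBasis.
Variables (F : fieldType) (n : nat) (A E P : 'M[F]_n).
Variables (blk pos copos : 'I_n -> nat).

Hypothesis node_inj : forall k l, blk k = blk l -> pos k = pos l -> k = l.
Hypothesis blk_size : forall k l,
  blk k = blk l -> (pos k + copos k = pos l + copos l)%N.
Hypothesis blk_full : forall k m, (m <= pos k + copos k)%N ->
  exists2 l, blk l = blk k & pos l = m.

Let J : 'M[F]_n :=
  \matrix_(k, l) ((blk k == blk l) && ((pos k).+1 == pos l))%:R.

Hypothesis PE : P *m E = 1%:M.
Hypothesis AE : A = E *m J *m P.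

Let EP : E *m P = 1%:M. Proof. exact: mulmx1C PE. Qed.

Definition node_label k := (pos k, copos k).

Lemma node_pred k : (0 < pos k)%N ->
  exists2 l, blk l = blk k & (pos l).+1 = pos k.
Proof.
move=> k0; have [|l bl pl] := @blk_full k (pos k).-1; first lia.
by exists l => //; rewrite pl prednK.
Qed.

Lemma node_succ k : (0 < copos k)%N ->
  exists2 l, blk l = blk k & pos l = (pos k).+1.
Proof. by move=> k0; apply: blk_full; lia. Qed.

Lemma J_mul_succ (M : 'M[F]_n) l i k : blk i = blk l -> pos i = (pos l).+1 ->
  (J *m M) l k = M i k.
Proof.
move=> bi pi; rewrite mxE (bigD1 i) //= !mxE bi pi !eqxx mul1r.
rewrite big1 ?addr0 // => j ne_j; rewrite mxE.
case: eqP => [bj|_]; last by rewrite mul0r.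
case: eqP => [pj|_]; last by rewrite mul0r.
by case/eqP: ne_j; apply: node_inj; rewrite ?bi ?pi.
Qed.

Lemma J_mul_last (M : 'M[F]_n) l k : copos l = 0%N -> (J *m M) l k = 0.
Proof.
move=> l0; rewrite mxE big1 // => j _; rewrite mxE.
case: eqP => [bj|_]; last by rewrite mul0r.
case: eqP => [pj|_]; last by rewrite mul0r.
by have := blk_size bj; lia.
Qed.

Lemma mul_J_pred (M : 'M[F]_n) l i k : blk i = blk k -> (pos i).+1 = pos k ->
  (M *m J) l k = M l i.
Proof.
move=> bi pi; rewrite mxE (bigD1 i) //= !mxE bi pi !eqxx mulr1.
rewrite big1 ?addr0 // => j ne_j; rewrite mxE.
case: eqP => [bj|_]; last by rewrite mulr0.
case: eqP => [pj|_]; last by rewrite mulr0.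
by case/eqP: ne_j; apply: node_inj; [rewrite bj bi | lia].
Qed.

Lemma mul_J_first (M : 'M[F]_n) l k : pos k = 0%N -> (M *m J) l k = 0.
Proof.
by move=> k0; rewrite mxE big1 // => j _; rewrite mxE k0 andbF mulr0.
Qed.

(** Commutation with J says that the entries of N are constant along the
    simultaneous steps in both chains.  Following the steps to the kernel ends
    shows that N cannot raise the height, following them to the generators shows
    that it cannot lower the depth. *)
Lemma commJ_support (N : 'M[F]_n) l k : J *m N = N *m J -> N l k != 0 ->
  cone_le (node_label l) (node_label k).
Proof.
move=> JN; have JNE i j : (J *m N) i j = (N *m J) i j by rewrite JN.
have le_pos m i j : pos j = m -> N i j != 0 -> (pos i <= m)%N.
  elim: m i j => [|m IHm] i j pj Nij; rewrite leqNgt; apply/negP => m_i.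
    have [|i' bi' pi'] := @node_pred i; first lia.
    case/eqP: Nij; rewrite -(J_mul_succ N j (esym bi') (esym pi')) JNE.
    exact: mul_J_first.
  have [|i' bi' pi'] := @node_pred i; first lia.
  have [|j' bj' pj'] := @node_pred j; first by rewrite pj.
  move: Nij; rewrite -(J_mul_succ N j (esym bi') (esym pi')) JNE.
  rewrite (mul_J_pred N i' bj' pj') => Nij.
  have pj'm : pos j' = m by lia.
  by have := IHm i' j' pj'm Nij; lia.
have le_copos m i j : copos i = m -> N i j != 0 -> (copos j <= m)%N.
  elim: m i j => [|m IHm] i j ci Nij; rewrite leqNgt; apply/negP => m_j.
    have [|j' bj' pj'] := @node_succ j; first lia.
    case/eqP: Nij; rewrite -(mul_J_pred N i (esym bj') (esym pj')) -JNE.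
    exact: J_mul_last.
  have [|i' bi' pi'] := @node_succ i; first by rewrite ci.
  have [|j' bj' pj'] := @node_succ j; first lia.
  move: Nij; rewrite -(mul_J_pred N i (esym bj') (esym pj')) -JNE.
  rewrite (J_mul_succ N j' bi' pi') => Nij.
  have ci'm : copos i' = m by have := blk_size bi'; lia.
  by have := IHm i' j' ci'm Nij; have := blk_size bj'; lia.
move=> Nlk; rewrite /cone_le /=.
by rewrite (le_pos _ _ _ erefl Nlk) (le_copos _ _ _ erefl Nlk).
Qed.

(** The map from the chain of k0 to the chain of l0 that sends k0 to l0 and
    commutes with steps; it sends the vectors of small height to zero.  The
    equation between heights is written without subtraction. *)
Definition shift_mx k0 l0 : 'M[F]_n :=
  \matrix_(l, k) [&& blk l == blk l0, blk k == blk k0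
                   & pos l + pos k0 == pos k + pos l0]%N%:R.

(** By the condition on depths the chain of l0 continues above l0 at least as
    far as the chain of k0 above k0, so that the shift cuts nothing off at the
    generators. *)
Lemma shift_comm k0 l0 : cone_le (node_label l0) (node_label k0) ->
  J *m shift_mx k0 l0 = shift_mx k0 l0 *m J.
Proof.
rewrite /cone_le /= => /andP[le_pos le_copos]; apply/matrixP => l k.
have [l0'|/node_succ[i bi pi]] := posnP (copos l).
  rewrite J_mul_last //; have [k0'|/node_pred[j bj pj]] := posnP (pos k).
    by rewrite mul_J_first.
  rewrite (mul_J_pred _ _ bj pj) mxE.
  case: and3P => // -[/eqP bl /eqP bk /eqP e].
  have := blk_size bl; have := blk_size bk; have := blk_size bj; lia.
rewrite (J_mul_succ _ _ bi pi) mxE bi pi.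
have [k0'|/node_pred[j bj pj]] := posnP (pos k).
  rewrite mul_J_first //; case: and3P => // -[/eqP bl /eqP bk /eqP e].
  exfalso; lia.
rewrite (mul_J_pred _ _ bj pj) mxE bj -pj.
by congr [&& _, _ & _]%:R; lia.
Qed.

Definition coord (u : 'cV[F]_n) k := (P *m u) k 0.
Definition node k := col k E.

Lemma coord_node k l : coord (node k) l = (l == k)%:R.
Proof. by rewrite /coord /node colE mulmxA PE mul1mx mxE eqxx andbT. Qed.

Lemma coord_expand u : u = \sum_k coord u k *: node k.
Proof.
rewrite -[LHS]mul1mx -EP -mulmxA; apply/colP => i.
rewrite [LHS]mxE summxE; apply: eq_bigr => k _.
by rewrite [RHS]mxE [node k i 0]mxE mulrC.
Qed.

Lemma comm_transport M : J *m M = M *m J -> comm_mx A (E *m M *m P).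
Proof.
move=> JM; rewrite /comm_mx AE -!mulmxA !(mulmxA P E) PE !mul1mx.
by congr (E *m _); rewrite !mulmxA JM.
Qed.

Lemma coord_conj M u l : coord (E *m M *m P *m u) l = \sum_k M l k * coord u k.
Proof. by rewrite /coord -!mulmxA (mulmxA P E) PE mul1mx mxE. Qed.

Lemma hyperinvariant_shift (U : {vspace 'cV[F]_n}) k l :
    hyperinvariant A U -> cone_le (node_label l) (node_label k) ->
  node k \in U -> node l \in U.
Proof.
move=> hU lk /(hU _ (comm_transport (shift_comm lk))).
suff -> : E *m shift_mx k l *m P *m node k = node l by [].
rewrite [LHS]coord_expand (bigD1 l) //= coord_conj.
rewrite (bigD1 k) //= coord_node mxE !eqxx addnC eqxx mulr1.
rewrite !big1 ?addr0 ?scale1r // => i ne_i.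
  rewrite coord_conj big1 ?scale0r // => j _; rewrite coord_node mxE.
  have [->|_] := eqVneq j k; last by rewrite mulr0.
  rewrite mulr1; case: and3P => // -[/eqP bi _ /eqP pi].
  by case/eqP: ne_i; apply: node_inj => //; lia.
by rewrite coord_node (negPf ne_i) mulr0.
Qed.

(** Let t be the highest vertex of the chain of k in the support of u.  Shifting
    the chain down by the right amount maps u to a vector with highest vertex j,
    for every j below t; by induction on the height its other terms are in U. *)
Lemma hyperinvariant_node (U : {vspace 'cV[F]_n}) u k :
  hyperinvariant A U -> u \in U -> coord u k != 0 -> node k \in U.
Proof.
move=> hU uU uk.
have [t /andP[/eqP bt ut] tmax] :=
  @arg_maxnP _ k (fun i => (blk i == blk k) && (coord u i != 0)) pos
    (introT andP (conj (eqxx _) uk)).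
suff down m j : blk j = blk k -> pos j = m -> (m <= pos t)%N -> node j \in U.
  by apply: (down (pos k)) => //; apply: tmax; rewrite eqxx.
elim/ltn_ind: m j => m IHm j bj pj le_m.
have jt : cone_le (node_label j) (node_label t).
  have := blk_size (etrans bj (esym bt)); rewrite /cone_le /=; lia.
set w := E *m shift_mx t j *m P *m u.
have wU : w \in U by apply: hU uU; apply/comm_transport/shift_comm.
have wj : coord w j = coord u t.
  rewrite coord_conj (bigD1 t) //= mxE !eqxx addnC eqxx mul1r.
  rewrite big1 ?addr0 // => i ne_i; rewrite mxE.
  case: and3P => [[_ /eqP bi /eqP pi]|]; last by rewrite mul0r.
  by case/eqP: ne_i; apply: node_inj => //; lia.
have rest : \sum_(i | i != j) coord w i *: node i \in U.
  apply: memv_suml => i ne_i; have [->|wi] := eqVneq (coord w i) 0.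
    by rewrite scale0r mem0v.
  move: wi; rewrite coord_conj => /sum_neq0[i']; rewrite mxE.
  case: and3P => [[/eqP bi /eqP bi' /eqP pi]|]; last by rewrite mul0r eqxx.
  rewrite mul1r => ui'; apply: memvZ.
  have le_t : (pos i' <= pos t)%N by apply: tmax; rewrite bi' bt eqxx.
  have ne_p : pos i <> pos j by move=> e; case/eqP: ne_i; apply: node_inj.
  by apply: (IHm (pos i)); rewrite ?bi //; clear -pi le_t le_m ne_p pj; lia.
move: wU; rewrite (coord_expand w) (bigD1 j) //= wj (rpredDr _ rest) => wU.
by have := memvZ (coord u t)^-1 wU; rewrite scalerA mulVf // scale1r.
Qed.

Lemma mem_hyperinvariant (U : {vspace 'cV[F]_n}) u : hyperinvariant A U ->
  (u \in U) <-> (forall k, coord u k != 0 -> node k \in U).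
Proof.
move=> hU; split=> [uU k|Uu]; first exact: hyperinvariant_node.
rewrite (coord_expand u); apply: memv_suml => k _.
by have [->|/Uu Uk] := eqVneq (coord u k) 0; rewrite ?scale0r ?mem0v ?memvZ.
Qed.

(** Defined as a kernel, so that membership is a condition on coordinates. *)
Definition node_space (D : pred 'I_n) : {vspace 'cV[F]_n} :=
  lker (linfun (mulmx (\matrix_(k, l) if D k then 0 else P k l))).

Lemma mem_node_space D u :
  (u \in node_space D) <-> (forall k, coord u k != 0 -> D k).
Proof.
rewrite memv_ker lfunE /=; have E0 k :
    ((\matrix_(k, l) if D k then 0 else P k l) *m u) k 0 =
    if D k then 0 else coord u k.
  rewrite /coord !mxE; case: ifP => Dk; last first.
    by apply: eq_bigr => l _; rewrite mxE Dk.
  by rewrite big1 // => l _; rewrite mxE Dk mul0r.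
split=> [/eqP u0 k|uD].
  by apply: contraNT => nDk; have := E0 k; rewrite u0 mxE (negPf nDk) => <-.
apply/eqP/colP => k; rewrite E0 mxE; case: ifPn => // nDk.
by apply/eqP; apply: contraNT nDk => /uD.
Qed.

Lemma node_space_node D k : (node k \in node_space D) = D k.
Proof.
apply/idP/idP => [/mem_node_space/(_ k)|Dk].
  by rewrite coord_node eqxx oner_eq0; apply.
apply/mem_node_space => l; rewrite coord_node.
by have [->|] := eqVneq l k; rewrite // eqxx.
Qed.

Lemma node_space_hyperinvariant (D : pred (nat * nat)) :
    (forall k l, cone_le (node_label l) (node_label k) ->
       D (node_label k) -> D (node_label l)) ->
  `[< hyperinvariant A (node_space (fun k => D (node_label k))) >].
Proof.
move=> Ddown; apply/asboolP => B AB u /mem_node_space uD.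
apply/mem_node_space => l.
pose N := P *m B *m E.
have BN : B = E *m N *m P by rewrite /N !mulmxA EP mul1mx -mulmxA EP mulmx1.
have JN : J *m N = N *m J.
  have JA : J = P *m A *m E by rewrite AE !mulmxA PE mul1mx -mulmxA PE mulmx1.
  rewrite JA /N !mulmxA -(mulmxA _ E P) -[X in X *m B *m E]mulmxA EP mulmx1.
  by rewrite -[in RHS](mulmxA _ E P) EP mulmx1 -!mulmxA (mulmxA A) AB !mulmxA.
rewrite BN coord_conj => /sum_neq0[k].
rewrite mulf_eq0 negb_or => /andP[Nlk uk].
exact: Ddown (commJ_support JN Nlk) (uD k uk).
Qed.

Variable X : pred (nat * nat).
Hypothesis X_label : forall k, X (node_label k).
Hypothesis label_X : forall p, X p -> exists k, node_label k = p.

Lemma below_down p k l : cone_le (node_label l) (node_label k) ->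
  cone_le (node_label k) p -> cone_le (node_label l) p.
Proof. exact: cone_le_trans. Qed.

Definition principal p : Hinv A :=
  HinvSub (@node_space_hyperinvariant (cone_le^~ p) (@below_down p)).

Lemma principal_le k (U : Hinv A) :
  (principal (node_label k) <= U)%O = (node k \in (U : {vspace 'cV[F]_n})).
Proof.
apply/idP/idP => [/subvP|Uk].
  by apply; rewrite node_space_node cone_le_refl.
apply/subvP => u /mem_node_space uk.
apply: (iffRL (mem_hyperinvariant u (@hinvP _ _ _ U))).
by move=> l /uk lk; apply: hyperinvariant_shift (@hinvP _ _ _ U) lk Uk.
Qed.

Lemma jordan_principal_family : principal_family X principal.
Proof.
split=> [p q /label_X[k <-] /label_X[l <-]|p U V /label_X[k <-]|U V UV|D Ddown].
- by rewrite principal_le node_space_node.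
- rewrite !principal_le => /memv_addP[u uU [v vV e]].
  have := coord_node k k; rewrite e eqxx /coord mulmxDr mxE => uv1.
  have [u0|u0] := eqVneq (coord u k) 0; last first.
        by rewrite -e (hyperinvariant_node (@hinvP _ _ _ U) uU u0).
  have v0 : coord v k != 0.
    by move: uv1; rewrite -!/(coord _ _) u0 add0r => ->; rewrite oner_eq0.
  by rewrite -e (hyperinvariant_node (@hinvP _ _ _ V) vV v0) orbT.
- apply/subvP => u uinU.
  have uU := iffLR (mem_hyperinvariant u (@hinvP _ _ _ U)) uinU.
  apply: (iffRL (mem_hyperinvariant u (@hinvP _ _ _ V))) => k /uU Uk.
  by rewrite -principal_le; apply: UV => //; rewrite principal_le.
have Ddown' k l : cone_le (node_label l) (node_label k) ->
    D (node_label k) -> D (node_label l) by apply: Ddown.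
exists (HinvSub (node_space_hyperinvariant Ddown')) => p /label_X[k <-].
by rewrite principal_le node_space_node.
Qed.

End JordanBasis.

(** * The basis given by the Segre characteristic *)

Section SegreNodes.
Variables (F : fieldType) (s : seq nat).

Let size_at (i : 'I_(size s)) := nth 0%N s i.
Let N := (\sum_(i < size s) size_at i)%N.

Definition segre_blk (k : 'I_N) : nat := tagnat.sig1 k.
Definition segre_pos (k : 'I_N) : nat := tagnat.sig2 k.
Definition segre_copos (k : 'I_N) : nat :=
  (size_at (tagnat.sig1 k) - (segre_pos k).+1)%N.

Lemma nilp_jordan_mxE (k l : 'I_N) : nilp_jordan_mx F s k l =
  ((segre_blk k == segre_blk l) && ((segre_pos k).+1 == segre_pos l))%:R.
Proof.
have conform a b (i : 'I_a) (j : 'I_b) : a = b ->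
    conform_mx (0 : 'M_(a, b)) (nilp_jordan_block F a) i j = (i.+1 == j)%:R.
  by move=> e; case: _ / e j => j; rewrite conform_mx_id mxE.
rewrite /nilp_jordan_mx /mxdiag mxE /segre_blk (inj_eq val_inj).
by case: eqP => [e|_]; rewrite ?mxE // conform // -e.
Qed.

Lemma segre_pos_lt (k : 'I_N) : (segre_pos k < size_at (tagnat.sig1 k))%N.
Proof. exact: ltn_ord. Qed.

Lemma segre_node_inj (k l : 'I_N) :
  segre_blk k = segre_blk l -> segre_pos k = segre_pos l -> k = l.
Proof.
have Rank_eq (i j : 'I_(size s)) (a : 'I_(size_at i)) (b : 'I_(size_at j)) :
    i = j -> a = b :> nat -> tagnat.Rank i a = tagnat.Rank j b.
  by move=> e; case: _ / e b => b ab; congr tagnat.Rank; apply: val_inj.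
move=> /val_inj bkl pkl; rewrite -(tagnat.sig2K k) -(tagnat.sig2K l).
exact: Rank_eq.
Qed.

Lemma segre_copos_sum (k : 'I_N) :
  (segre_pos k + segre_copos k).+1 = size_at (tagnat.sig1 k).
Proof. by have := segre_pos_lt k; rewrite /segre_copos; lia. Qed.

Lemma segre_blk_size (k l : 'I_N) : segre_blk k = segre_blk l ->
  (segre_pos k + segre_copos k = segre_pos l + segre_copos l)%N.
Proof. by move=> /val_inj e; apply: succn_inj; rewrite !segre_copos_sum e. Qed.

Lemma segre_node (i : 'I_(size s)) m : (m < size_at i)%N ->
  exists k : 'I_N, tagnat.sig1 k = i /\ segre_pos k = m.
Proof.
move=> mi; exists (tagnat.Rank i (Ordinal mi)); rewrite tagnat.Rank1K.
by split=> //; rewrite /segre_pos tagnat.Rank2K.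
Qed.

Lemma segre_blk_full (k : 'I_N) m : (m <= segre_pos k + segre_copos k)%N ->
  exists2 l, segre_blk l = segre_blk k & segre_pos l = m.
Proof.
rewrite -ltnS segre_copos_sum => /segre_node[l [bl pl]].
by exists l; rewrite // /segre_blk bl.
Qed.

Definition segre_label (k : 'I_N) := (segre_pos k, segre_copos k).

Lemma points_segre_label (k : 'I_N) : points (undup s) (segre_label k).
Proof.
by rewrite /points /= segre_copos_sum mem_undup mem_nth.
Qed.

Lemma segre_label_points p : points (undup s) p ->
  exists k : 'I_N, segre_label k = p.
Proof.
case: p => x y; rewrite /points mem_undup /= => /(nthP 0%N)[i si e].
have [|k [bk pk]] := @segre_node (Ordinal si) x.
  by rewrite /size_at /= e; lia.
exists k; have := segre_copos_sum k; rewrite /segre_label pk bk /size_at /= e.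
by move=> exy; congr (_, _); lia.
Qed.

End SegreNodes.

(** The only place where the Jordan form is used: P carries A to it, so the
    columns of the inverse of P are a Jordan basis. *)
Lemma segre_principal_family (F : fieldType) n (A : 'M[F]_n) alpha :
    is_reduced_segre A alpha ->
  reduced alpha /\
  exists pr : nat * nat -> Hinv A, principal_family (points alpha) pr.
Proof.
case=> s [ss s0 [e simA]] ->; split.
  rewrite /reduced gtn_sorted_uniq_geq undup_uniq /=; apply/andP; split.
    by apply: subseq_sorted (undup_subseq s) ss => x y z /=; lia.
  by apply/allP => x; rewrite mem_undup => /(allP s0).
move: A simA; case: _ / e => A [P Punit /(simmxP Punit) PA].
have AE : A = invmx P *m (\matrix_(k, l) ((segre_blk k == segre_blk l) &&
    ((segre_pos k).+1 == segre_pos l))%:R) *m P.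
  rewrite (_ : \matrix_(_, _) _ = nilp_jordan_mx F s); last first.
    by apply/matrixP => k l; rewrite nilp_jordan_mxE mxE.
  by move: PA; rewrite castmx_id -mulmxA => <-; rewrite mulKmx.
eexists; exact: (jordan_principal_family (@segre_node_inj s)
  (@segre_blk_size s) (@segre_blk_full s) (mulmxV Punit) AE
  (@points_segre_label s) (@segre_label_points s)).
Qed.

Theorem theorem5p13 (R : realType) (n : nat) (A B : 'M[R[i]]_n)
    (alpha beta : seq nat)
    (nilA : nilpotent_mx A) (nilB : nilpotent_mx B)
    (segA : is_reduced_segre A alpha) (segB : is_reduced_segre B beta) :
  lattice_isomorphic (Hinv A) (Hinv B) <->
  [\/ (alpha = [:: 5; 2]%N /\ beta = [:: 4; 2; 1]%N) \/
      (alpha = [:: 4; 2; 1]%N /\ beta = [:: 5; 2]%N),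
      exists2 l : nat, (2 <= l)%N &
        (alpha = [:: l; (l - 1)%N] /\ beta = [:: (2 * l - 1)%N]) \/
        (alpha = [:: (2 * l - 1)%N] /\ beta = [:: l; (l - 1)%N])
    | alpha = beta].
Proof.
have [redA [prA famA]] := segre_principal_family segA.
have [redB [prB famB]] := segre_principal_family segB.
apply: iff_trans (points_iso_related redA redB).
split=> [iso|[f [g fg]]]; first exact: poset_iso_of_lattice_iso famA famB iso.
exact: lattice_iso_of_poset_iso famA famB fg.
Qed.
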